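(* Let $\mathbb{K}$ be a $\mathcal{C}^{\infty}$-field, and define the covariant functor (composition of contravariant functors) $$\check{K}=\widehat{k}\circ\operatorname{Stone}:\mathbf{BA}\to\mathcal{C}^{\infty}\mathbf{vNRing}.$$ Then there is a natural isomorphism $$\theta:\operatorname{Id}_{\mathbf{BA}}\overset{\cong}{\Longrightarrow}\widetilde{B}\circ\check{K}.$$ Therefore: (1) the functor $\check{K}$ is faithful; (2) the functor $\widetilde{B}:\mathcal{C}^{\infty}\mathbf{vNRing}\to\mathbf{BA}$ is full up to conjugation, i.e. for every homomorphism of Boolean algebras $h:B\to B'$ there exist von Neumann regular $\mathcal{C}^{\infty}$-rings $A,A'$, a $\mathcal{C}^{\infty}$-homomorphism $f:A\to A'$ and isomorphisms of Boolean algebras $\psi:B\to\widetilde{B}(A)$, $\psi':B'\to\widetilde{B}(A')$ such that $h=\psi'^{-1}\circ\widetilde{B}(f)\circ\psi$; (3) the functor $\widetilde{B}:\mathcal{C}^{\infty}\mathbf{vNRing}\to\mathbf{BA}$ is isomorphism-dense; in particular, given any $\mathcal{C}^{\infty}$-field $\mathbb{K}$ and any Boolean algebra $B$, there is a von Neumann regular $\mathcal{C}^{\infty}$-ring which is a $\mathbb{K}$-algebra, namely $\check{K}(B)$, such that $\widetilde{B}(\check{K}(B))\cong B$.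
   Context: A $\mathcal{C}^{\infty}$-ring is a non-empty set $A$ with, for each $n\in\mathbb{N}$ and each smooth $f:\mathbb{R}^n\to\mathbb{R}$, an operation $\Phi(f):A^n\to A$, such that projections are interpreted as projections and $\Phi(h\circ(g_1,\dots,g_n))=\Phi(h)\circ(\Phi(g_1),\dots,\Phi(g_n))$ for all smooth $h:\mathbb{R}^n\to\mathbb{R}$, $g_i:\mathbb{R}^m\to\mathbb{R}$. A $\mathcal{C}^{\infty}$-homomorphism is a map commuting with all these operations. Every $\mathcal{C}^{\infty}$-ring has an underlying commutative unital ring. A $\mathcal{C}^{\infty}$-field is a $\mathcal{C}^{\infty}$-ring whose underlying ring is a field. $A$ is von Neumann regular if for every $a\in A$ there is $x\in A$ with $a=a^2x$. $\mathcal{C}^{\infty}\mathbf{vNRing}$ is the full subcategory of $\mathcal{C}^{\infty}$-rings on the von Neumann regular ones. $\mathbf{BA}$ is the category of Boolean algebras and their homomorphisms. $\widetilde{B}$ sends a $\mathcal{C}^{\infty}$-ring $A$ to the Boolean algebra $\widetilde{B}(A)=\{e\in A\mid e^2=e\}$ of idempotents, with $e\wedge e'=ee'$, $e\vee e'=e+e'-ee'$, $e^*=1-e$, and sends a $\mathcal{C}^{\infty}$-homomorphism to its restriction to idempotents. A Boolean space is a compact, Hausdorff, totally disconnected space; $\mathbf{BoolSp}$ is the category of Boolean spaces and continuous maps. $\operatorname{Stone}:\mathbf{BA}\to\mathbf{BoolSp}$ is the contravariant functor sending $B$ to the set of ultrafilters of $B$ with the topology with basis $\{U\mid b\in U\}$,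 $b\in B$, and $h:B\to B'$ to $U\mapsto h^{-1}(U)$. For a Boolean space $X$, $\mathcal{R}_X$ is the set of equivalence relations $R\subseteq X\times X$ such that the quotient space $X/R$ is discrete and compact, partially ordered by inclusion. If $R_j\subseteq R_i$ in $\mathcal{R}_X$ there is the canonical surjection $\mu_{R_jR_i}:X/R_j\to X/R_i$. The contravariant functor $\widehat{k}:\mathbf{BoolSp}\to\mathcal{C}^{\infty}\mathbf{vNRing}$ sends $X$ to $A_X=\varinjlim_{R\in\mathcal{R}_X}\mathbb{K}^{U(X/R)}$, where $U(X/R)$ is the underlying set of $X/R$, $\mathbb{K}^{U(X/R)}$ is the product $\mathcal{C}^{\infty}$-ring, and the directed colimit in $\mathcal{C}^{\infty}$-rings is taken along the maps $\mathbb{K}^{U(X/R_i)}\to\mathbb{K}^{U(X/R_j)}$, $u\mapsto u\circ\mu_{R_jR_i}$, for $R_j\subseteq R_i$. For a continuous $f:X\to X'$ and $R'\in\mathcal{R}_{X'}$, put $R'_f=(f\times f)^{-1}[R']\in\mathcal{R}_X$ and let $f_{R'_fR'}:X/R'_f\to X'/R'$ be the induced map; $\widehat{k}(f):A_{X'}\to A_X$ is induced on colimits by the maps $u\mapsto u\circ f_{R'_fR'}$. A functor is isomorphism-dense if every object of the target is isomorphic to one in its image. *)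

(* Defs.v *)
From HB Require Import structures.
From mathcomp Require Import all_boot all_order all_algebra.
From mathcomp Require Import ring.
From mathcomp Require Import all_classical all_reals.
From mathcomp Require Import topology normedtype derive.

Set Implicit Arguments.
Unset Strict Implicit.
Unset Printing Implicit Defensive.

Import Order.Theory GRing.Theory Num.Theory.
Import numFieldNormedType.Exports.

Local Open Scope classical_set_scope.
Local Open Scope quotient_scope.
Local Open Scope ring_scope.

Record category := Category {
  ob :> Type;
  hom : ob -> ob -> Type;
  idm : forall x, hom x x;
  comp : forall x y z, hom y z -> hom x y -> hom x z;
  comp_idl : forall x y (f : hom x y), comp (idm y) f = f;
  comp_idr : forall x y (f : hom x y), comp f (idm x) = f;
  compA : forall x y z t (h : hom z t) (g : hom y z) (f : hom x y),
    comp h (comp g f) = comp (comp h g) f }.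

Arguments idm {c} x.
Arguments comp {c x y z}.

Definition is_iso (C : category) (x y : C) (f : hom x y) : Prop :=
  exists g : hom y x, comp g f = idm x /\ comp f g = idm y.

Record iso (C : category) (x y : C) := Iso {
  iso_hom :> hom x y;
  iso_inv : hom y x;
  iso_invK : comp iso_inv iso_hom = idm x;
  iso_homK : comp iso_hom iso_inv = idm y }.

Record functor (C D : category) := Functor {
  fob :> C -> D;
  fmap : forall x y, hom x y -> hom (fob x) (fob y);
  fmap_id : forall x, fmap (idm x) = idm (fob x);
  fmap_comp : forall x y z (g : hom y z) (f : hom x y),
    fmap (comp g f) = comp (fmap g) (fmap f) }.

Arguments fmap {C D} _ {x y}.

Record cofunctor (C D : category) := Cofunctor {
  cob :> C -> D;
  cmap : forall x y, hom x y -> hom (cob y) (cob x);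
  cmap_id : forall x, cmap (idm x) = idm (cob x);
  cmap_comp : forall x y z (g : hom y z) (f : hom x y),
    cmap (comp g f) = comp (cmap f) (cmap g) }.

Arguments cmap {C D} _ {x y}.

Definition functor_id (C : category) : functor C C :=
  @Functor C C (fun x => x) (fun x y f => f)
    (fun=> erefl) (fun x y z g f => erefl).

Program Definition functor_comp (C D E : category)
    (G : functor D E) (F : functor C D) : functor C E :=
  @Functor C E (fun x => G (F x)) (fun x y f => fmap G (fmap F f)) _ _.
Next Obligation. by move=> C D E G F x /=; rewrite !fmap_id. Qed.
Next Obligation. by move=> C D E G F x y z g f /=; rewrite !fmap_comp. Qed.

Program Definition cofunctor_comp (C D E : category)
    (G : cofunctor D E) (F : cofunctor C D) : functor C E :=
  @Functor C E (fun x => G (F x)) (fun x y f => cmap G (cmap F f)) _ _.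
Next Obligation. by move=> C D E G F x /=; rewrite !cmap_id. Qed.
Next Obligation. by move=> C D E G F x y z g f /=; rewrite !cmap_comp. Qed.

Record nat_trans (C D : category) (F G : functor C D) := NatTrans {
  nt_hom :> forall x, hom (F x) (G x);
  nt_nat : forall x y (f : hom x y),
    comp (nt_hom y) (fmap F f) = comp (fmap G f) (nt_hom x) }.

Definition nat_iso (C D : category) (F G : functor C D)
  (t : nat_trans F G) : Prop := forall x, is_iso (t x).

Definition full_subcategory (C : category) (P : C -> Prop) : category :=
  @Category {x : C | P x} (fun x y => hom (sval x) (sval y))
    (fun x => idm (sval x)) (fun x y z g f => comp g f)
    (fun x y f => comp_idl f) (fun x y f => comp_idr f)
    (fun x y z t h g f => compA h g f).

Definition full_incl (C : category) (P : C -> Prop) :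
    functor (full_subcategory P) C :=
  @Functor (full_subcategory P) C (fun x => sval x) (fun x y f => f)
    (fun=> erefl) (fun x y z g f => erefl).

Definition faithful (C D : category) (F : functor C D) : Prop :=
  forall (x y : C) (f g : hom x y), fmap F f = fmap F g -> f = g.

Definition iso_dense (C D : category) (F : functor C D) : Prop :=
  forall y : D, exists x : C, inhabited (iso (F x) y).

Definition full_up_to_conjugation (C D : category) (F : functor C D) : Prop :=
  forall (y y' : D) (h : hom y y'),
  exists (x x' : C) (f : hom x x') (psi : iso y (F x)) (psi' : iso y' (F x')),
    h = comp (iso_inv psi') (comp (fmap F f) psi).

Section Smooth.
Context {R : realType}.

Definition partial n (i : 'I_n) (f : 'rV[R]_n -> R) : 'rV[R]_n -> R :=
  fun x => 'D_(delta_mx 0 i : 'rV[R]_n) f x.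

Fixpoint Ck (k n : nat) (f : 'rV[R]_n -> R) : Prop :=
  match k with
  | 0 => continuous f
  | k'.+1 => continuous f /\
      forall i : 'I_n, (forall x, derivable f x (delta_mx 0 i : 'rV[R]_n)) /\
                       Ck k' (partial i f)
  end.

Definition smooth n (f : 'rV[R]_n -> R) : Prop := forall k, Ck k f.

Lemma CkS k n (f : 'rV[R]_n -> R) : Ck k.+1 f -> Ck k f.
Proof.
elim: k f => [|k IH] f [cf df]; first by [].
by split=> // i; have [d1 d2] := df i; split=> //; exact: IH.
Qed.

Lemma CkD k n (f g : 'rV[R]_n -> R) : Ck k f -> Ck k g -> Ck k (f + g).
Proof.
elim: k f g => [|k IH] f g.
  by move=> cf cg x; apply: continuousD; [exact: cf|exact: cg].
move=> [cf df] [cg dg]; split.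
  by move=> x; apply: continuousD; [exact: cf|exact: cg].
move=> i; have [f1 f2] := df i; have [g1 g2] := dg i.
split; first by move=> x; exact: derivableD.
rewrite (_ : partial i _ = partial i f + partial i g); first exact: IH.
by apply/funext => x; rewrite /partial deriveD.
Qed.

Lemma CkM k n (f g : 'rV[R]_n -> R) : Ck k f -> Ck k g -> Ck k (f * g).
Proof.
elim: k f g => [|k IH] f g.
  by move=> cf cg x; apply: continuousM; [exact: cf|exact: cg].
move=> Cf Cg; have [cf df] := Cf; have [cg dg] := Cg.
split; first by move=> x; apply: continuousM; [exact: cf|exact: cg].
move=> i; have [f1 f2] := df i; have [g1 g2] := dg i.
split; first by move=> x; exact: derivableM.
rewrite (_ : partial i _ = f * partial i g + g * partial i f); last first.
  by apply/funext => x; rewrite /partial deriveM.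
by apply: CkD; apply: IH => //; exact: CkS.
Qed.

Lemma smooth_cst n (c : R) : smooth (cst c : 'rV[R]_n -> R).
Proof.
move=> k; elim: k c => [|k IH] c; first by exact: cst_continuous.
split; first by exact: cst_continuous.
move=> i; split; first by move=> x; exact: derivable_cst.
rewrite (_ : partial i _ = cst 0); first exact: IH.
by apply/funext => x; rewrite /partial derive_cst.
Qed.

Lemma smooth_proj n (i : 'I_n) : smooth (fun x : 'rV[R]_n => x 0 i).
Proof.
case=> [|k]; first exact: coord_continuous.
split; first exact: coord_continuous.
move=> j.
have dd (x : 'rV[R]_n) : is_derive x (delta_mx 0 j : 'rV[R]_n)
    (fun x : 'rV[R]_n => x 0 i) ((delta_mx 0 j : 'rV[R]_n) 0 i).
  have H : (fun h : R =>
      h^-1 *: ((h *: (delta_mx 0 j : 'rV[R]_n) + x) 0 i - x 0 i))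
      @ 0^' --> (delta_mx 0 j : 'rV[R]_n) 0 i.
    apply: (@cvg_trans _ (cst ((delta_mx 0 j : 'rV[R]_n) 0 i) @ (0 : R)^'));
      last exact: cvg_cst.
    apply: near_eq_cvg; near=> h.
    rewrite /cst [X in _ *: (X - _)]mxE [X in (X + _) - _]mxE addrK.
    rewrite scalerA mulVf ?scale1r//.
    by near: h; exact: nbhs_dnbhs_neq.
  apply: DeriveDef; last exact: (cvg_lim _ H).
  by apply/cvg_ex; eexists; exact: H.
split; first by move=> x; have [] := dd x.
rewrite (_ : partial j _ = cst ((delta_mx 0 j : 'rV[R]_n) 0 i)).
  exact: smooth_cst.
by apply/funext => x; rewrite /partial derive_val.
Unshelve. all: by end_near. Qed.

Lemma smoothD n (f g : 'rV[R]_n -> R) : smooth f -> smooth g -> smooth (f + g).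
Proof. by move=> sf sg k; exact: CkD. Qed.

Lemma smoothM n (f g : 'rV[R]_n -> R) : smooth f -> smooth g -> smooth (f * g).
Proof. by move=> sf sg k; exact: CkM. Qed.

Lemma smoothN n (f : 'rV[R]_n -> R) : smooth f -> smooth (- f).
Proof.
move=> sf; rewrite (_ : - f = cst (-1) * f); last first.
  by apply/funext => x; rewrite /cst /GRing.mul /GRing.opp /= mulN1r.
by apply: smoothM => //; exact: smooth_cst.
Qed.

End Smooth.

(* In [cinf_comp] the smoothness of the composite is a hypothesis, for every
   proof of it; by the chain rule it always holds, so the axiom covers all
   smooth [h] and [g]. *)
Record cinfRing (R : realType) := CinfRing {
  cinf_sort :> Type;
  cinf_op : forall n (f : 'rV[R]_n -> R), smooth f ->
    ('I_n -> cinf_sort) -> cinf_sort;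
  cinf_proj : forall n (i : 'I_n) (s : smooth (fun x : 'rV[R]_n => x 0 i)) v,
    cinf_op s v = v i;
  cinf_comp : forall m n (h : 'rV[R]_n -> R) (g : 'I_n -> 'rV[R]_m -> R)
    (sh : smooth h) (sg : forall i, smooth (g i))
    (s : smooth (fun x => h (\row_i g i x))) v,
    cinf_op s v = cinf_op sh (fun i => cinf_op (sg i) v) }.

Arguments cinf_op {R} c {n f} _ _.

Record cinfHom (R : realType) (A B : cinfRing R) := CinfHom {
  cinf_fun :> A -> B;
  cinf_funP : forall n (f : 'rV[R]_n -> R) (s : smooth f) v,
    cinf_fun (cinf_op A s v) = cinf_op B s (fun i => cinf_fun (v i)) }.

Lemma cinfHom_ext (R : realType) (A B : cinfRing R) (f g : cinfHom A B) :
  f =1 g -> f = g.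
Proof.
case: f g => [f pf] [g pg] /= /funext fg; rewrite fg in pf *.
by congr CinfHom; exact: Prop_irrelevance.
Qed.

Definition cinfHom_id (R : realType) (A : cinfRing R) : cinfHom A A :=
  @CinfHom R A A (fun x => x) (fun n f s v => erefl).

Program Definition cinfHom_comp (R : realType) (A B C : cinfRing R)
    (g : cinfHom B C) (f : cinfHom A B) : cinfHom A C :=
  @CinfHom R A C (fun x => g (f x)) _.
Next Obligation. by move=> R A B C g f n h s v /=; rewrite !cinf_funP. Qed.

Definition CinfRng (R : realType) : category.
Proof.
refine (@Category (cinfRing R) (@cinfHom R) (@cinfHom_id R)
  (@cinfHom_comp R) _ _ _) => *; exact: cinfHom_ext.
Defined.

HB.instance Definition _ (R : realType) (A : cinfRing R) :=
  gen_eqMixin (cinf_sort A).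
HB.instance Definition _ (R : realType) (A : cinfRing R) :=
  gen_choiceMixin (cinf_sort A).

Section UnderlyingRing.
Context {R : realType} (A : cinfRing R).

Lemma smooth_add2 : smooth (fun x : 'rV[R]_2 => x 0 ord0 + x 0 ord_max).
Proof. exact: smoothD (smooth_proj _) (smooth_proj _). Qed.

Lemma smooth_mul2 : smooth (fun x : 'rV[R]_2 => x 0 ord0 * x 0 ord_max).
Proof. exact: smoothM (smooth_proj _) (smooth_proj _). Qed.

Lemma smooth_opp1 : smooth (fun x : 'rV[R]_1 => - x 0 ord0).
Proof. exact: smoothN (smooth_proj _). Qed.

Definition cinf_pair (a b : A) : 'I_2 -> A :=
  fun i => if i == ord0 then a else b.

Definition cinf_cst (c : R) : A :=
  cinf_op A (@smooth_cst R 0 c) (fun i => False_rect A (notF (ltn_ord i))).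
Definition cinf_add (a b : A) : A := cinf_op A smooth_add2 (cinf_pair a b).
Definition cinf_mul (a b : A) : A := cinf_op A smooth_mul2 (cinf_pair a b).
Definition cinf_opp (a : A) : A := cinf_op A smooth_opp1 (fun=> a).

Lemma cinf_op_ext n (f g : 'rV[R]_n -> R) (sf : smooth f) (sg : smooth g) v :
  f =1 g -> cinf_op A sf v = cinf_op A sg v.
Proof.
move=> /funext fg; rewrite -fg in sg *.
by rewrite (Prop_irrelevance sf sg).
Qed.

Lemma cinf_compE m n (h : 'rV[R]_n -> R) (g : 'I_n -> 'rV[R]_m -> R)
    (f : 'rV[R]_m -> R) (sh : smooth h) (sg : forall i, smooth (g i))
    (sf : smooth f) v :
  (forall x, f x = h (\row_i g i x)) ->
  cinf_op A sh (fun i => cinf_op A (sg i) v) = cinf_op A sf v.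
Proof.
by move=> /funext fE; rewrite -cinf_comp -?fE// => s; exact: cinf_op_ext.
Qed.

Lemma cinf_op_cst n (c : R) (s : smooth (cst c : 'rV[R]_n -> R)) v :
  cinf_op A s v = cinf_cst c.
Proof.
rewrite /cinf_cst; set w := (X in _ = cinf_op A _ X).
pose g (i : 'I_0) := (cst 0 : 'rV[R]_n -> R).
rewrite (_ : w = fun i => cinf_op A ((@smooth_cst R n 0) : smooth (g i)) v); last first.
  by apply/funext => -[].
by rewrite (cinf_compE _ _ s).
Qed.

Lemma cinf_op_add n (f g : 'rV[R]_n -> R) (sf : smooth f) (sg : smooth g) v :
  cinf_add (cinf_op A sf v) (cinf_op A sg v) = cinf_op A (smoothD sf sg) v.
Proof.
pose F (i : 'I_2) := if i == ord0 then f else g.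
have sF i : smooth (F i) by rewrite /F; case: ifP => _; [exact: sf|exact: sg].
rewrite -(cinf_compE smooth_add2 sF (smoothD sf sg)); last by move=> x; rewrite !mxE.
congr cinf_op; apply/funext => i; rewrite /cinf_pair.
by case: ifPn => i0; apply: cinf_op_ext => x; rewrite /F ?i0// (negbTE i0).
Qed.

Lemma cinf_op_mul n (f g : 'rV[R]_n -> R) (sf : smooth f) (sg : smooth g) v :
  cinf_mul (cinf_op A sf v) (cinf_op A sg v) = cinf_op A (smoothM sf sg) v.
Proof.
pose F (i : 'I_2) := if i == ord0 then f else g.
have sF i : smooth (F i) by rewrite /F; case: ifP => _; [exact: sf|exact: sg].
rewrite -(cinf_compE smooth_mul2 sF (smoothM sf sg)); last by move=> x; rewrite !mxE.
congr cinf_op; apply/funext => i; rewrite /cinf_pair.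
by case: ifPn => i0; apply: cinf_op_ext => x; rewrite /F ?i0// (negbTE i0).
Qed.

Lemma cinf_op_opp n (f : 'rV[R]_n -> R) (sf : smooth f) v :
  cinf_opp (cinf_op A sf v) = cinf_op A (smoothN sf) v.
Proof.
by apply: (@cinf_compE n 1 _ (fun=> f) _ smooth_opp1 (fun=> sf)) => x; rewrite mxE.
Qed.

(* the ring axioms are polynomial identities in at most three variables *)
Let var3 (a b c : A) : exists v : 'I_3 -> A,
  [/\ a = cinf_op A (@smooth_proj R 3 0) v,
      b = cinf_op A (@smooth_proj R 3 1) v &
      c = cinf_op A (@smooth_proj R 3 (inord 2)) v].
Proof.
exists (fun i => tnth [tuple a; b; c] i); rewrite !cinf_proj.
by split=> //; rewrite (tnth_nth a) inordK.
Qed.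

Let opE := (cinf_op_add, cinf_op_mul, cinf_op_opp).

Lemma cinf_addA : associative cinf_add.
Proof.
move=> a b c; have [v [-> -> ->]] := var3 a b c; rewrite !opE.
by apply: cinf_op_ext => x; rewrite addrA.
Qed.

Lemma cinf_addC : commutative cinf_add.
Proof.
move=> a b; have [v [-> -> _]] := var3 a b a; rewrite !opE.
by apply: cinf_op_ext => x; rewrite addrC.
Qed.

Lemma cinf_add0 : left_id (cinf_cst 0) cinf_add.
Proof.
move=> a; have [v [-> _ _]] := var3 a a a.
rewrite -(cinf_op_cst (@smooth_cst R 3 0) v) !opE.
by apply: cinf_op_ext => x; rewrite [LHS]add0r.
Qed.

Lemma cinf_addN : left_inverse (cinf_cst 0) cinf_opp cinf_add.
Proof.
move=> a; have [v [-> _ _]] := var3 a a a.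
rewrite -(cinf_op_cst (@smooth_cst R 3 0) v) !opE.
by apply: cinf_op_ext => x; rewrite [LHS]addNr.
Qed.

Lemma cinf_mulA : associative cinf_mul.
Proof.
move=> a b c; have [v [-> -> ->]] := var3 a b c; rewrite !opE.
by apply: cinf_op_ext => x; rewrite mulrA.
Qed.

Lemma cinf_mulC : commutative cinf_mul.
Proof.
move=> a b; have [v [-> -> _]] := var3 a b a; rewrite !opE.
by apply: cinf_op_ext => x; rewrite mulrC.
Qed.

Lemma cinf_mul1 : left_id (cinf_cst 1) cinf_mul.
Proof.
move=> a; have [v [-> _ _]] := var3 a a a.
rewrite -(cinf_op_cst (@smooth_cst R 3 1) v) !opE.
by apply: cinf_op_ext => x; rewrite [LHS]mul1r.
Qed.

Lemma cinf_mulDl : left_distributive cinf_mul cinf_add.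
Proof.
move=> a b c; have [v [-> -> ->]] := var3 a b c; rewrite !opE.
by apply: cinf_op_ext => x; rewrite mulrDl.
Qed.

End UnderlyingRing.

HB.instance Definition _ (R : realType) (A : cinfRing R) :=
  GRing.isZmodule.Build (cinf_sort A)
    (@cinf_addA R A) (@cinf_addC R A) (@cinf_add0 R A) (@cinf_addN R A).
HB.instance Definition _ (R : realType) (A : cinfRing R) :=
  GRing.Zmodule_isComPzRing.Build (cinf_sort A)
    (@cinf_mulA R A) (@cinf_mulC R A) (@cinf_mul1 R A) (@cinf_mulDl R A).

Section HomTheory.
Context {R : realType} {A B : cinfRing R} (f : cinfHom A B).

Lemma cinfHom_cst c : f (cinf_cst A c) = cinf_cst B c.
Proof.
by rewrite cinf_funP; congr cinf_op; apply/funext => -[].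
Qed.

Lemma cinfHomD : {morph f : x y / x + y}.
Proof.
move=> x y; rewrite [LHS]cinf_funP; congr cinf_op; apply/funext => i.
by rewrite /cinf_pair; case: ifP.
Qed.

Lemma cinfHomM : {morph f : x y / x * y}.
Proof.
move=> x y; rewrite [LHS]cinf_funP; congr cinf_op; apply/funext => i.
by rewrite /cinf_pair; case: ifP.
Qed.

Lemma cinfHomN : {morph f : x / - x}.
Proof. by move=> x; rewrite [LHS]cinf_funP. Qed.

Lemma cinfHom0 : f 0 = 0. Proof. exact: cinfHom_cst. Qed.
Lemma cinfHom1 : f 1 = 1. Proof. exact: cinfHom_cst. Qed.

End HomTheory.

Definition cinf_field (R : realType) (K : cinfRing R) : Prop :=
  (1 : K) != 0 /\ forall x : K, x != 0 -> exists y : K, x * y = 1.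

(* a K-algebra structure on A is a C-infinity homomorphism K -> A *)
Definition is_algebra (R : realType) (K A : cinfRing R) : Prop :=
  inhabited (cinfHom K A).

Definition von_neumann_regular (R : realType) (A : cinfRing R) : Prop :=
  forall a : A, exists x : A, a = a ^+ 2 * x.

Definition CinfvNRng (R : realType) : category :=
  full_subcategory (@von_neumann_regular R : CinfRng R -> Prop).

Section Power.
Context {R : realType} (K : cinfRing R) (S : Type).

Definition cinf_pow : cinfRing R.
Proof.
refine (@CinfRing R (S -> K)
  (fun n f s v => fun t => cinf_op K s (fun i => v i t)) _ _).
- by move=> n i s v; apply/funext => t; rewrite cinf_proj.
- by move=> m n h g sh sg s v; apply/funext => t; rewrite (cinf_comp sh sg).
Defined.

End Power.

Definition cinf_pow_map (R : realType) (K : cinfRing R) (S T : Type)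
    (g : S -> T) : cinfHom (cinf_pow K T) (cinf_pow K S) :=
  @CinfHom R (cinf_pow K T) (cinf_pow K S) (fun u => u \o g)
    (fun n f s v => erefl).

Lemma cinf_pow_vnr (R : realType) (K : cinfRing R) (S : Type) :
  cinf_field K -> von_neumann_regular (cinf_pow K S).
Proof.
move=> [_ Kf] a.
have H t : exists y, a t = (a t) ^+ 2 * y.
  have [->|/Kf[y ay]] := eqVneq (a t) 0; first by exists 0; rewrite mulr0.
  by exists y; rewrite expr2 -mulrA ay mulr1.
have [x xP] := choice H; exists (x : cinf_pow K S).
have ev (t : S) : exists e : cinfHom (cinf_pow K S) K, forall u, e u = u t.
  by unshelve eexists (@CinfHom R (cinf_pow K S) K (fun u => u t) _).
apply/funext => t; have [e eE] := ev t.
by rewrite -[RHS]eE expr2 !cinfHomM !eE -expr2 -xP.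
Qed.

Record boolAlg := BoolAlg {
  ba_disp : Order.disp_t;
  ba_sort :> ctbDistrLatticeType ba_disp }.

(* Mathcomp's [{tblmorphism B -> B'}] only asks for preservation of bottom and
   top, hence this record; preservation of complements follows. *)
Record baHom (B B' : boolAlg) := BaHom {
  ba_fun :> B -> B';
  ba_homI : Order.meet_morphism ba_fun;
  ba_homU : Order.join_morphism ba_fun;
  ba_hom0 : ba_fun \bot%O = \bot%O;
  ba_hom1 : ba_fun \top%O = \top%O }.

Lemma baHom_ext (B B' : boolAlg) (f g : baHom B B') : f =1 g -> f = g.
Proof.
case: f g => [f f1 f2 f3 f4] [g g1 g2 g3 g4] /= /funext fg.
rewrite fg in f1 f2 f3 f4 *.
by congr BaHom; exact: Prop_irrelevance.
Qed.

Definition baHom_id (B : boolAlg) : baHom B B :=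
  @BaHom B B (fun x => x) (fun _ _ => erefl) (fun _ _ => erefl) erefl erefl.

Definition baHom_comp (B B' B'' : boolAlg) (g : baHom B' B'') (f : baHom B B') :
  baHom B B''.
Proof.
refine (@BaHom B B'' (fun x => g (f x)) _ _ _ _).
- by move=> x y; rewrite !ba_homI.
- by move=> x y; rewrite !ba_homU.
- by rewrite !ba_hom0.
- by rewrite !ba_hom1.
Defined.

Definition BA : category.
Proof.
refine (@Category boolAlg baHom baHom_id baHom_comp _ _ _) => *; exact: baHom_ext.
Defined.

Section Idempotents.
Context {R : realType} (A : cinfRing R).

Definition idem : Type := {e : A | e ^+ 2 == e}.
Definition Idem (e : A) (h : e ^+ 2 == e) : idem := exist _ e h.

HB.instance Definition _ := Choice.on idem.
HB.instance Definition _ := [isSub of idem for @sval A (fun e => e ^+ 2 == e)].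

Implicit Types e : idem.

Lemma idemP e : val e * val e = val e.
Proof. by rewrite -expr2; exact/eqP/(valP e). Qed.

Lemma idem_ext e e' : val e = val e' -> e = e'.
Proof. exact: val_inj. Qed.

Fact idem_meet_subproof e e' : (val e * val e') ^+ 2 == val e * val e'.
Proof. by rewrite expr2 mulrACA !idemP. Qed.

Fact idem_join_subproof e e' :
  (val e + val e' - val e * val e') ^+ 2 == val e + val e' - val e * val e'.
Proof.
have h1 := idemP e; have h2 := idemP e'; apply/eqP.
move: (val e) (val e') h1 h2 => a b h1 h2.
have -> : (a + b - a * b) ^+ 2 = a * a + b * b + a * b *+ 2
   - (a * a) * b *+ 2 - a * (b * b) *+ 2 + (a * a) * (b * b) by ring.
by rewrite h1 h2; ring.
Qed.

Fact idem_compl_subproof e : (1 - val e) ^+ 2 == 1 - val e.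
Proof.
have h1 := idemP e; apply/eqP; move: (val e) h1 => a h1.
have -> : (1 - a) ^+ 2 = 1 - a *+ 2 + a * a by ring.
by rewrite h1; ring.
Qed.

Fact idem_bot_subproof : (0 : A) ^+ 2 == 0.
Proof. by rewrite expr2 mul0r. Qed.

Fact idem_top_subproof : (1 : A) ^+ 2 == 1.
Proof. by rewrite expr1n. Qed.

Definition idem_meet e e' : idem := Idem (idem_meet_subproof e e').
Definition idem_join e e' : idem := Idem (idem_join_subproof e e').
Definition idem_compl e : idem := Idem (idem_compl_subproof e).
Definition idem_bot : idem := Idem idem_bot_subproof.
Definition idem_top : idem := Idem idem_top_subproof.

Let vE : (forall e e', val (idem_meet e e') = val e * val e') *
  (forall e e', val (idem_join e e') = val e + val e' - val e * val e') *
  (forall e, val (idem_compl e) = 1 - val e) *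
  (val idem_bot = 0) * (val idem_top = 1).
Proof. by []. Qed.

Definition idem_le e e' := idem_meet e e' == e.
Definition idem_lt e e' := (e' != e) && idem_le e e'.

Fact idem_meetC : commutative idem_meet.
Proof. by move=> e e'; apply: idem_ext; rewrite !vE mulrC. Qed.
Fact idem_joinC : commutative idem_join.
Proof. by move=> e e'; apply: idem_ext; rewrite !vE; ring. Qed.
Fact idem_meetA : associative idem_meet.
Proof. by move=> e e' e''; apply: idem_ext; rewrite !vE mulrA. Qed.
Fact idem_joinA : associative idem_join.
Proof. by move=> e e' e''; apply: idem_ext; rewrite !vE; ring. Qed.
Fact idem_joinKI e' e : idem_meet e (idem_join e e') = e.
Proof. by apply: idem_ext; rewrite !vE mulrBr mulrDr mulrA idemP addrK. Qed.
Fact idem_meetKU e' e : idem_join e (idem_meet e e') = e.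
Proof. by apply: idem_ext; rewrite !vE mulrA idemP addrK. Qed.
Fact idem_meetUl : left_distributive idem_meet idem_join.
Proof.
move=> e e' e''; apply: idem_ext; rewrite !vE.
by rewrite mulrACA idemP; ring.
Qed.
Fact idem_meetxx : idempotent_op idem_meet.
Proof. by move=> e; apply: idem_ext; rewrite !vE idemP. Qed.

HB.instance Definition _ := @Order.isMeetJoinDistrLattice.Build
  (Order.Disp tt tt) idem idem_le idem_lt idem_meet idem_join
  (fun _ _ => erefl) (fun _ _ => erefl) idem_meetC idem_joinC idem_meetA
  idem_joinA idem_joinKI idem_meetKU idem_meetUl idem_meetxx.

Fact idem_le0x e : (idem_bot <= e)%O.
Proof. by apply/eqP/idem_ext; rewrite !vE mul0r. Qed.
Fact idem_lex1 e : (e <= idem_top)%O.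
Proof. by apply/eqP/idem_ext; rewrite !vE mulr1. Qed.

HB.instance Definition _ :=
  @Order.hasBottom.Build (Order.Disp tt tt) idem idem_bot idem_le0x.
HB.instance Definition _ :=
  @Order.hasTop.Build (Order.Disp tt tt) idem idem_top idem_lex1.

Fact idem_joinxC e : idem_join e (idem_compl e) = idem_top.
Proof. by apply: idem_ext; rewrite !vE mulrBr mulr1 idemP subrr subr0 addrC subrK. Qed.
Fact idem_meetxC e : idem_meet e (idem_compl e) = idem_bot.
Proof. by apply: idem_ext; rewrite !vE mulrBr mulr1 idemP subrr. Qed.

HB.instance Definition _ := @Order.TBDistrLattice_hasComplement.Build
  (Order.Disp tt tt) idem idem_compl idem_joinxC idem_meetxC.

Definition idemAlg : boolAlg := @BoolAlg (Order.Disp tt tt) idem.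

End Idempotents.

Section IdempotentsMap.
Context {R : realType} (A A' : cinfRing R) (f : cinfHom A A').

Fact idem_map_subproof (e : idem A) : f (val e) ^+ 2 == f (val e).
Proof. by rewrite expr2 -cinfHomM idemP. Qed.

Definition idem_map : baHom (idemAlg A) (idemAlg A').
Proof.
refine (@BaHom (idemAlg A) (idemAlg A')
  (fun e => Idem (idem_map_subproof e)) _ _ _ _).
- by move=> e e'; apply: idem_ext; rewrite /= cinfHomM.
- by move=> e e'; apply: idem_ext; rewrite /= !cinfHomD cinfHomN cinfHomM.
- by apply: idem_ext; rewrite /= cinfHom0.
- by apply: idem_ext; rewrite /= cinfHom1.
Defined.

End IdempotentsMap.

Definition Btilde (R : realType) : functor (CinfRng R) BA.
Proof.
refine (@Functor (CinfRng R) BA (@idemAlg R) (@idem_map R) _ _).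
- by move=> A; apply: baHom_ext => e; apply: idem_ext.
- by move=> A A' A'' g f; apply: baHom_ext => e; apply: idem_ext.
Defined.

Record dirsys (R : realType) := Dirsys {
  ds_idx :> Type;
  ds_le : ds_idx -> ds_idx -> Prop;
  ds_inh : inhabited ds_idx;
  ds_refl : forall i, ds_le i i;
  ds_trans : forall i j k, ds_le i j -> ds_le j k -> ds_le i k;
  ds_dir : forall i j, exists k, ds_le i k /\ ds_le j k;
  ds_ob : ds_idx -> cinfRing R;
  ds_map : forall i j, ds_le i j -> cinfHom (ds_ob i) (ds_ob j);
  ds_map_id : forall i (h : ds_le i i) a, ds_map h a = a;
  ds_map_comp : forall i j k (ij : ds_le i j) (jk : ds_le j k) (ik : ds_le i k) a,
    ds_map jk (ds_map ij a) = ds_map ik a }.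

Arguments ds_map {R} d {i j} _.

Section Colimit.
Context {R : realType} (D : dirsys R).

Definition colim_pre : Type := {i : D & ds_ob i}.
HB.instance Definition _ := gen_eqMixin colim_pre.
HB.instance Definition _ := gen_choiceMixin colim_pre.

Definition colim_in (i : D) (a : ds_ob i) : colim_pre := Tagged (@ds_ob R D) a.

Definition colim_rel (x y : colim_pre) : bool :=
  `[< exists k (h : ds_le (tag x) k) (h' : ds_le (tag y) k),
      ds_map D h (tagged x) = ds_map D h' (tagged y) >].

Lemma colim_rel_refl : reflexive colim_rel.
Proof.
by move=> x; apply/asboolP; exists (tag x), (ds_refl _), (ds_refl _).
Qed.

Lemma colim_rel_sym : symmetric colim_rel.
Proof.
by move=> x y; apply/asboolP/asboolP => -[k [h [h' e]]]; exists k, h', h.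
Qed.

Lemma colim_rel_trans : transitive colim_rel.
Proof.
move=> y x z /asboolP[k [h [h' e]]] /asboolP[l [g [g' e']]].
have [m [km lm]] := ds_dir k l; apply/asboolP.
exists m, (ds_trans h km), (ds_trans g' lm).
rewrite -(ds_map_comp h km) -(ds_map_comp g' lm) e -e'.
by rewrite (ds_map_comp h' km (ds_trans h' km)) (ds_map_comp g lm (ds_trans h' km)).
Qed.

Canonical colim_equiv :=
  EquivRel colim_rel colim_rel_refl colim_rel_sym colim_rel_trans.

Definition colim_type : Type := {eq_quot colim_rel}.

Definition colim_pi (i : D) (a : ds_ob i) : colim_type :=
  \pi_({eq_quot colim_rel}) (colim_in a).

Lemma colim_piP i j (a : ds_ob i) (b : ds_ob j) :
  colim_pi a = colim_pi b <->
  exists k (h : ds_le i k) (h' : ds_le j k), ds_map D h a = ds_map D h' b.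
Proof.
split=> [/eqmodP/asboolP//|H]; apply/eqmodP; exact/asboolP.
Qed.

Lemma colim_pi_map i j (h : ds_le i j) (a : ds_ob i) :
  colim_pi (ds_map D h a) = colim_pi a.
Proof.
apply/colim_piP; exists j, (ds_refl j), h; exact: ds_map_id.
Qed.

Definition colim_repr (z : colim_type) : colim_pre :=
  repr (z : {eq_quot colim_rel}).

Lemma colim_reprK z : colim_pi (tagged (colim_repr z)) = z.
Proof.
rewrite -[RHS](reprK (z : {eq_quot colim_rel})) /colim_pi.
by congr (\pi_ _ _); rewrite /colim_in /colim_repr; case: (repr _).
Qed.

Lemma ds_bound n (i : 'I_n -> D) : exists j, forall k, ds_le (i k) j.
Proof.
elim: n i => [|n IH] i; first by have [j] := ds_inh D; exists j => -[].
have [j jP] := IH (fun k => i (lift ord0 k)).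
have [m [m1 m2]] := ds_dir (i ord0) j; exists m => k.
by have [l ->|->//] := unliftP ord0 k; exact: ds_trans (jP l) m2.
Qed.

Definition colim_idx n (v : 'I_n -> colim_type) : D :=
  sval (cid (ds_bound (fun k => tag (colim_repr (v k))))).

Lemma colim_idxP n (v : 'I_n -> colim_type) k :
  ds_le (tag (colim_repr (v k))) (colim_idx v).
Proof. by rewrite /colim_idx; case: cid => j /=; apply. Qed.

Definition colim_op n (f : 'rV[R]_n -> R) (s : smooth f)
    (v : 'I_n -> colim_type) : colim_type :=
  colim_pi (cinf_op (ds_ob (colim_idx v)) s
    (fun k => ds_map D (colim_idxP v k) (tagged (colim_repr (v k))))).

Lemma colim_opE n (f : 'rV[R]_n -> R) (s : smooth f) j (b : 'I_n -> ds_ob j) :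
  colim_op s (fun k => colim_pi (b k)) = colim_pi (cinf_op (ds_ob j) s b).
Proof.
rewrite /colim_op; set v := fun k => colim_pi (b k).
have H k : colim_pi (tagged (colim_repr (v k))) = colim_pi (b k) by exact: colim_reprK.
have {H} /choice[m mP] : forall k, exists m : D,
    exists (h : ds_le (tag (colim_repr (v k))) m) (h' : ds_le j m),
    ds_map D h (tagged (colim_repr (v k))) = ds_map D h' (b k).
  by move=> k; have /colim_piP := H k.
have [l0 l0P] := ds_bound m.
have [l1 [l01 jl1]] := ds_dir l0 j.
have [l [l1l il]] := ds_dir l1 (colim_idx v).
have jl := ds_trans jl1 l1l.
apply/colim_piP; exists l, il, jl; rewrite !cinf_funP; congr cinf_op.
apply/funext => k; have [h [h' e]] := mP k.
have ml : ds_le (m k) l := ds_trans (ds_trans (l0P k) l01) l1l.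
rewrite (ds_map_comp _ _ (ds_trans h ml)) -(ds_map_comp h ml) e.
by rewrite (ds_map_comp h' ml jl).
Qed.

Lemma colim_lift n (v : 'I_n -> colim_type) :
  exists (j : D) (b : 'I_n -> ds_ob j), v = fun k => colim_pi (b k).
Proof.
exists (colim_idx v),
  (fun k => ds_map D (colim_idxP v k) (tagged (colim_repr (v k)))).
by apply/funext => k; rewrite colim_pi_map colim_reprK.
Qed.

Definition colim : cinfRing R.
Proof.
refine (@CinfRing R colim_type colim_op _ _).
- move=> n i s v; have [j [b ->]] := colim_lift v.
  by rewrite colim_opE cinf_proj.
- move=> m n h g sh sg s v; have [j [b ->]] := colim_lift v.
  rewrite colim_opE (cinf_comp sh sg) -colim_opE; congr colim_op.
  by apply/funext => i; rewrite colim_opE.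
Defined.

Definition colim_map (i : D) : cinfHom (ds_ob i) colim :=
  @CinfHom R (ds_ob i) colim (@colim_pi i)
    (fun n f s v => esym (colim_opE s v)).

Lemma colim_map_compat i j (h : ds_le i j) a :
  colim_map j (ds_map D h a) = colim_map i a.
Proof. exact: colim_pi_map. Qed.

Section Universal.
Context (C : cinfRing R) (g : forall i : D, cinfHom (ds_ob i) C).
Context (gP : forall i j (h : ds_le i j) a, g j (ds_map D h a) = g i a).

Definition colim_desc_fun (z : colim) : C :=
  g (tag (colim_repr z)) (tagged (colim_repr z)).

Lemma colim_desc_funE i a : colim_desc_fun (colim_map i a) = g i a.
Proof.
rewrite /colim_desc_fun; set z := colim_map i a.
have /colim_piP[k [h [h' e]]] :
  colim_pi (tagged (colim_repr z)) = colim_pi a by exact: colim_reprK.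
by rewrite -(gP h) e gP.
Qed.

Definition colim_desc : cinfHom colim C.
Proof.
refine (@CinfHom R colim C colim_desc_fun _) => n f s v.
have [j [b ->]] := colim_lift v.
rewrite -[X in colim_desc_fun X](cinf_funP (colim_map j)).
rewrite colim_desc_funE cinf_funP; congr cinf_op; apply/funext => k.
by rewrite -colim_desc_funE.
Defined.

Lemma colim_descE i a : colim_desc (colim_map i a) = g i a.
Proof. exact: colim_desc_funE. Qed.

End Universal.

Lemma colim_ind (P : colim -> Prop) :
  (forall i a, P (colim_map i a)) -> forall z, P z.
Proof. by move=> H z; rewrite -(colim_reprK z); exact: H. Qed.

(* with [colim_map_compat] and [colim_descE]: [colim] is the colimit *)
Lemma colim_uniq (C : cinfRing R) (f f' : cinfHom colim C) :
  (forall i a, f (colim_map i a) = f' (colim_map i a)) -> f = f'.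
Proof. by move=> H; apply: cinfHom_ext; exact: colim_ind. Qed.

Lemma colim_vnr :
  (forall i : D, von_neumann_regular (ds_ob i)) -> von_neumann_regular colim.
Proof.
move=> H; apply: colim_ind => i a; have [x xP] := H i a.
by exists (colim_map i x); rewrite {1}xP !expr2 !cinfHomM.
Qed.

End Colimit.

Record boolSp := BoolSpace {
  bs_space :> topologicalType;
  bs_compact : compact [set: bs_space];
  bs_hausdorff : hausdorff_space bs_space;
  bs_totally_disconnected : totally_disconnected [set: bs_space] }.

Record ctsMap (X Y : topologicalType) := CtsMap {
  cts_fun :> X -> Y;
  cts_continuous : continuous cts_fun }.

Lemma ctsMap_ext (X Y : topologicalType) (f g : ctsMap X Y) : f =1 g -> f = g.
Proof.
case: f g => [f pf] [g pg] /= /funext fg; rewrite fg in pf *.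
by congr CtsMap; exact: Prop_irrelevance.
Qed.

Definition cts_id (X : topologicalType) : ctsMap X X :=
  @CtsMap X X (fun x => x) (fun x => cvg_id).

Definition cts_comp (X Y Z : topologicalType) (g : ctsMap Y Z) (f : ctsMap X Y) :
  ctsMap X Z.
Proof.
refine (@CtsMap X Z (fun x => g (f x)) _) => x.
by apply: continuous_comp; exact: cts_continuous.
Defined.

Definition BoolSp : category.
Proof.
refine (@Category boolSp (fun X Y => ctsMap X Y) (fun X => cts_id X)
  (fun X Y Z => @cts_comp X Y Z) _ _ _) => *; exact: ctsMap_ext.
Defined.

Section Ultrafilters.
Context (B : boolAlg).

Definition ba_proper_filter (F : set B) : Prop :=
  [/\ F \top%O, ~ F \bot%O, forall x y, F x -> F y -> F (Order.meet x y) &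
      forall x y, (x <= y)%O -> F x -> F y].

Definition ba_ultrafilter (U : set B) : Prop :=
  ba_proper_filter U /\
  forall G, ba_proper_filter G -> U `<=` G -> G = U.

Record stone := Ultra { uf_set : set B; uf_ultra : ba_ultrafilter uf_set }.

Implicit Types U V : stone.

Lemma ufT U : uf_set U \top%O. Proof. by case: (uf_ultra U) => -[]. Qed.
Lemma uf0 U : ~ uf_set U \bot%O. Proof. by case: (uf_ultra U) => -[]. Qed.
Lemma ufI U x y : uf_set U x -> uf_set U y -> uf_set U (Order.meet x y).
Proof. by case: (uf_ultra U) => -[_ _ + _] _; apply. Qed.
Lemma ufS U x y : (x <= y)%O -> uf_set U x -> uf_set U y.
Proof. by case: (uf_ultra U) => -[_ _ _ +] _; apply. Qed.

Lemma uf_ext U V : uf_set U `<=` uf_set V -> U = V.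
Proof.
case: U V => [U pU] [V pV] /= UV.
have E : V = U by apply: (pU.2 V pV.1 UV).
rewrite E in pV *; congr Ultra; exact: Prop_irrelevance.
Qed.

Lemma ufC U x : uf_set U x \/ uf_set U (Order.compl x).
Proof.
have [|nUx] := pselect (uf_set U x); [by left|right; apply: contrapT => nUc].
pose G : set B := [set y | exists u, uf_set U u /\ (Order.meet u x <= y)%O].
have GU : G = uf_set U.
  apply: (uf_ultra U).2 => [|u Uu]; last by exists u; split=> //; exact: leIl.
  split.
  - by exists \top%O; split; [exact: ufT|exact: lex1].
  - move=> [u [Uu]]; rewrite lex0 disj_leC => /ufS - /(_ _ Uu) //.
  - move=> y z [u [Uu uy]] [v [Uv vz]]; exists (Order.meet u v).
    split; first exact: ufI.
    rewrite lexI (le_trans _ uy) ?(le_trans _ vz)//.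
      by rewrite leI2// leIr.
    by rewrite leI2// leIl.
  - by move=> y z yz [u [Uu uy]]; exists u; split=> //; exact: le_trans yz.
by apply: nUx; rewrite -GU; exists \top%O; split; [exact: ufT|exact: leIr].
Qed.

Lemma uf_compl U x : uf_set U (Order.compl x) <-> ~ uf_set U x.
Proof.
split=> [Uc Ux|]; last by have [] := ufC U x.
by apply: (@uf0 U); rewrite -(meetxC x); exact: ufI.
Qed.

Lemma prime_ultrafilter (F : set B) : ba_proper_filter F ->
  (forall x, F x \/ F (Order.compl x)) -> ba_ultrafilter F.
Proof.
move=> pF FC; split=> // G [GT G0 GI GS] FG; apply/seteqP; split=> // x Gx.
have [//|Fc] := FC x; case: G0; rewrite -(meetxC x).
by apply: GI => //; exact: FG.
Qed.

HB.instance Definition _ := gen_eqMixin stone.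
HB.instance Definition _ := gen_choiceMixin stone.

(* the topology with basis the sets of ultrafilters containing [b] *)
Definition stone_open (W : set stone) : Prop :=
  forall U, W U -> exists b, uf_set U b /\ [set V : stone | uf_set V b] `<=` W.

Lemma stone_openT : stone_open setT.
Proof. by move=> U _; exists \top%O; split=> //; exact: ufT. Qed.

Lemma stone_openI : setI_closed stone_open.
Proof.
move=> W W' oW oW' U [/oW[b [Ub bW]] /oW'[b' [Ub' bW']]].
exists (Order.meet b b'); split; first exact: ufI.
by move=> V Vbb; split; [apply: bW|apply: bW']; apply: ufS Vbb;
  [exact: leIl|exact: leIr].
Qed.

Lemma stone_open_bigU (I : Type) (W : I -> set stone) :
  (forall i, stone_open (W i)) -> stone_open (\bigcup_i W i).
Proof.
move=> oW U [i _ /oW[b [Ub bW]]]; exists b; split=> // V /bW WV; by exists i.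
Qed.

HB.instance Definition _ := isOpenTopological.Build stone
  stone_openT stone_openI stone_open_bigU.

Lemma stone_openE (W : set stone) : open W = stone_open W.
Proof. by []. Qed.

Definition stone_basic (b : B) : set stone := [set V : stone | uf_set V b].

Lemma stone_basic_open b : open (stone_basic b).
Proof. by rewrite stone_openE => U Ub; exists b; split. Qed.

Lemma stone_basicC b : ~` stone_basic b = stone_basic (Order.compl b).
Proof. by apply/seteqP; split=> U /=; rewrite /stone_basic /= uf_compl. Qed.

Lemma stone_basic_clopen b : clopen (stone_basic b).
Proof.
split; first exact: stone_basic_open.
by rewrite -[stone_basic b]setCK stone_basicC; apply: open_closedC;
  exact: stone_basic_open.
Qed.

Lemma stone_separated U V : U != V -> exists b, uf_set U b /\ ~ uf_set V b.
Proof.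
move=> /eqP UV; apply: contrapT => H; apply: UV; apply: uf_ext => b Ub.
by apply: contrapT => nVb; apply: H; exists b.
Qed.

Lemma stone_compact : compact [set: stone].
Proof.
rewrite compact_ultra => F FU _.
pose U : set B := [set b | F (stone_basic b)].
have pU : ba_ultrafilter U.
  apply: prime_ultrafilter.
    split.
    - rewrite /U /= (_ : stone_basic _ = setT); first exact: filterT.
      by apply/seteqP; split=> // V _; exact: ufT.
    - rewrite /U /= (_ : stone_basic _ = set0); first exact: filter_not_empty.
      by apply/seteqP; split=> // V; exact: uf0.
    - move=> x y Ux Uy; apply: filterS (filterI Ux Uy) => V [Vx Vy].
      exact: ufI.
    - by move=> x y xy; apply: filterS => V; exact: ufS.
  by move=> x; rewrite /U /= -stone_basicC; exact: in_ultra_setVsetC.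
exists (Ultra pU); split=> // W.
rewrite nbhsE => -[W' [oW' /= W'U] W'W].
have [b [Ub bW]] := oW' _ W'U.
by apply: filterS Ub; apply: subset_trans W'W.
Qed.

Lemma stone_hausdorff : hausdorff_space stone.
Proof.
rewrite open_hausdorff => U V /stone_separated[b [Ub nVb]].
exists (stone_basic b, stone_basic (Order.compl b)).
  by split; rewrite inE; [exact: Ub|exact/uf_compl].
split; [exact: stone_basic_open|exact: stone_basic_open|].
by rewrite /= -stone_basicC setICr.
Qed.

Lemma stone_totally_disconnected : totally_disconnected [set: stone].
Proof.
apply: zero_dimension_totally_disconnected => U V /stone_separated[b [Ub nVb]].
by exists (stone_basic b); split=> //; exact: stone_basic_clopen.
Qed.

Definition stoneSp : boolSp :=
  BoolSpace stone_compact stone_hausdorff stone_totally_disconnected.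

End Ultrafilters.

Section StoneMap.
Context (B B' : boolAlg) (h : baHom B B').

Lemma stone_map_ultra (U : stone B') : ba_ultrafilter (h @^-1` uf_set U).
Proof.
apply: prime_ultrafilter.
  split; rewrite /preimage /=.
  - by rewrite ba_hom1; exact: ufT.
  - by rewrite ba_hom0; exact: uf0.
  - by move=> x y Ux Uy; rewrite ba_homI; exact: ufI.
  - move=> x y; rewrite leEmeet => /eqP xy Ux; move: Ux; rewrite -xy ba_homI.
    by apply: ufS; exact: leIr.
move=> x; have [Ux|nU] := ufC U (h x); first by left.
right; rewrite /preimage /=.
have : uf_set U (Order.meet (Order.compl (h x)) (h (Order.join x (Order.compl x)))).
  by rewrite joinxC ba_hom1; apply: ufI => //; exact: ufT.
rewrite ba_homU meetUr meetCx join0x; apply: ufS; exact: leIr.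
Qed.

Definition stone_map_fun (U : stone B') : stone B := Ultra (stone_map_ultra U).

Lemma stone_map_continuous : continuous stone_map_fun.
Proof.
apply/continuousP => W oW; rewrite stone_openE => U WU.
have [b [Ub bW]] := oW _ WU.
by exists (h b); split=> // V Vb; apply: bW.
Qed.

Definition stone_map : ctsMap (stoneSp B') (stoneSp B) :=
  @CtsMap (stoneSp B') (stoneSp B) stone_map_fun stone_map_continuous.

End StoneMap.

Definition Stone : cofunctor BA BoolSp.
Proof.
refine (@Cofunctor BA BoolSp stoneSp stone_map _ _).
- by move=> B; apply: ctsMap_ext => U; exact: uf_ext.
- by move=> B B' B'' g f; apply: ctsMap_ext => U; exact: uf_ext.
Defined.

Section DiscreteQuotients.
Context (X : topologicalType).

(* [X -> X -> Prop] rather than mathcomp's [equiv_rel X], whose universe is too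
   large for the index set of a colimit *)
Record eqvRel := EqvRel {
  eqv :> X -> X -> Prop;
  eqv_refl : forall x, eqv x x;
  eqv_sym : forall x y, eqv x y -> eqv y x;
  eqv_trans : forall x y z, eqv x y -> eqv y z -> eqv x z }.

Definition eqv_bool (e : eqvRel) : rel X := fun x y => `[< e x y >].

Lemma eqv_bool_refl e : reflexive (eqv_bool e).
Proof. by move=> x; apply/asboolP; exact: eqv_refl. Qed.

Lemma eqv_bool_sym e : symmetric (eqv_bool e).
Proof. by move=> x y; apply/asboolP/asboolP; exact: eqv_sym. Qed.

Lemma eqv_bool_trans e : transitive (eqv_bool e).
Proof.
by move=> y x z /asboolP xy /asboolP yz; apply/asboolP; exact: eqv_trans yz.
Qed.

Definition eqv_equiv (e : eqvRel) : equiv_rel X :=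
  EquivRel (eqv_bool e) (@eqv_bool_refl e) (@eqv_bool_sym e) (@eqv_bool_trans e).

Definition quotSpace (e : eqvRel) : topologicalType :=
  quotient_topology {eq_quot (eqv_equiv e)}.

Definition quot_pi (e : eqvRel) (x : X) : quotSpace e := \pi_(quotSpace e) x.
Definition quot_repr (e : eqvRel) (c : quotSpace e) : X := repr c.

Lemma quot_piP (e : eqvRel) x y : quot_pi e x = quot_pi e y <-> e x y.
Proof.
by split=> [/eqmodP/asboolP//|H]; apply/eqmodP/asboolP.
Qed.

Lemma quot_reprK (e : eqvRel) : cancel (@quot_repr e) (@quot_pi e).
Proof. by move=> c; exact: reprK. Qed.

Lemma quot_repr_pi (e : eqvRel) x : e (quot_repr (quot_pi e x)) x.
Proof. by apply/quot_piP; rewrite quot_reprK. Qed.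

Record dcrel := DCrel {
  dc_rel :> eqvRel;
  dc_discrete : forall A : set (quotSpace dc_rel), open A;
  dc_compact : compact [set: quotSpace dc_rel] }.

Lemma quot_pi_continuous (e : eqvRel) : continuous (@quot_pi e).
Proof. exact: pi_continuous. Qed.

Lemma dc_open_class (S : dcrel) x : open [set y | S x y].
Proof.
have /continuousP/(_ _ (dc_discrete [set quot_pi S x])) := @quot_pi_continuous S.
congr open; apply/seteqP; split=> y /=; first by move=> /esym/quot_piP.
by move=> H; apply/esym/quot_piP.
Qed.

Lemma open_class_discrete (e : eqvRel) :
  (forall x, open [set y | e x y]) -> forall A : set (quotSpace e), open A.
Proof.
move=> H A; suff : open (@quot_pi e @^-1` A) by [].
rewrite (_ : _ @^-1` _ = \bigcup_(x in @quot_pi e @^-1` A) [set y | e x y]).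
  by apply: bigcup_open => x _; exact: H.
apply/seteqP; split=> [y Ay|y [x Ax /= /quot_piP E]].
  by exists y => //=; exact: eqv_refl.
by rewrite /preimage /= -E.
Qed.

Lemma quotSpace_compact (e : eqvRel) :
  compact [set: X] -> compact [set: quotSpace e].
Proof.
move=> cX; have -> : [set: quotSpace e] = @quot_pi e @` [set: X].
  by apply/seteqP; split=> // c _; exists (quot_repr c) => //; exact: quot_reprK.
apply: continuous_compact => //; apply: continuous_subspaceT.
exact: quot_pi_continuous.
Qed.

Definition dcI_eqv (S T : eqvRel) : eqvRel.
Proof.
refine (@EqvRel (fun x y => S x y /\ T x y) _ _ _).
- by move=> x; split; exact: eqv_refl.
- by move=> x y [a b]; split; exact: eqv_sym.
- by move=> x y z [a b] [c d]; split; [exact: eqv_trans c|exact: eqv_trans d].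
Defined.

Lemma dcI_discrete (S T : dcrel) (A : set (quotSpace (dcI_eqv S T))) : open A.
Proof.
apply: open_class_discrete => x.
rewrite (_ : [set _ | _] = [set y | S x y] `&` [set y | T x y]) //.
by apply: openI; exact: dc_open_class.
Qed.

Definition dcI (cX : compact [set: X]) (S T : dcrel) : dcrel :=
  @DCrel (dcI_eqv S T) (@dcI_discrete S T) (@quotSpace_compact _ cX).

Definition dcT_eqv : eqvRel :=
  @EqvRel (fun _ _ => True) (fun=> I) (fun _ _ _ => I) (fun _ _ _ _ _ => I).

Lemma dcT_discrete (A : set (quotSpace dcT_eqv)) : open A.
Proof.
apply: open_class_discrete => x.
by rewrite (_ : [set _ | _] = setT); [exact: openT|apply/seteqP; split].
Qed.

Definition dcT (cX : compact [set: X]) : dcrel :=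
  @DCrel dcT_eqv dcT_discrete (@quotSpace_compact _ cX).

(* [dc_le S T] means that [T] is contained in [S]; then X/T maps onto X/S *)
Definition dc_le (S T : dcrel) : Prop := forall x y, T x y -> S x y.

Definition dc_mu (S T : dcrel) : quotSpace T -> quotSpace S :=
  fun c => quot_pi S (quot_repr c).

Lemma dc_mu_pi (S T : dcrel) : dc_le S T ->
  forall x, dc_mu S (quot_pi T x) = quot_pi S x.
Proof. by move=> ST x; apply/quot_piP/ST; exact: quot_repr_pi. Qed.

End DiscreteQuotients.

Section KhatObj.
Context {R : realType} (K : cinfRing R) (X : boolSp).

Definition khat_sys : dirsys R.
Proof.
refine (@Dirsys R (dcrel X) (@dc_le X) _ _ _ _
  (fun S => cinf_pow K (quotSpace S))
  (fun S T _ => cinf_pow_map K (@dc_mu X S T)) _ _).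
- by constructor; exact: dcT (@bs_compact X).
- by move=> S x y.
- by move=> S T U ST TU x y /TU/ST.
- move=> S T; exists (dcI (@bs_compact X) S T).
  by split=> x y [].
- move=> S SS u; apply/funext => c /=.
  by rewrite -[c in LHS]quot_reprK dc_mu_pi// quot_reprK.
- move=> S T U ST TU SU u; apply/funext => c /=.
  by rewrite -[c]quot_reprK !dc_mu_pi.
Defined.

Definition khat_ring : cinfRing R := colim khat_sys.

Lemma khat_ring_vnr : cinf_field K -> von_neumann_regular khat_ring.
Proof. by move=> Kf; apply: colim_vnr => S; exact: cinf_pow_vnr. Qed.

End KhatObj.

Section KhatMap.
Context {R : realType} (K : cinfRing R) (X Y : boolSp) (f : ctsMap X Y).

Definition dc_pull_eqv (S : eqvRel Y) : eqvRel X.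
Proof.
refine (@EqvRel X (fun x y => S (f x) (f y)) _ _ _).
- by move=> x; exact: eqv_refl.
- by move=> x y; exact: eqv_sym.
- by move=> x y z; exact: eqv_trans.
Defined.

Lemma dc_pull_discrete (S : dcrel Y) (A : set (quotSpace (dc_pull_eqv S))) :
  open A.
Proof.
apply: open_class_discrete => x.
have /continuousP/(_ _ (dc_open_class S (f x))) := @cts_continuous _ _ f.
by congr open.
Qed.

Definition dc_pull (S : dcrel Y) : dcrel X :=
  @DCrel X (dc_pull_eqv S) (@dc_pull_discrete S)
    (@quotSpace_compact X _ (@bs_compact X)).

Definition dc_pull_map (S : dcrel Y) (c : quotSpace (dc_pull S)) : quotSpace S :=
  quot_pi S (f (quot_repr c)).

Lemma dc_pull_map_pi (S : dcrel Y) x :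
  dc_pull_map (quot_pi (dc_pull S) x) = quot_pi S (f x).
Proof. by apply/quot_piP; exact: (quot_repr_pi (dc_pull S) x). Qed.

Definition khat_cocone (S : khat_sys K Y) :
    cinfHom (ds_ob S) (khat_ring K X) :=
  cinfHom_comp (@colim_map R (khat_sys K X) (dc_pull S))
    (cinf_pow_map K (@dc_pull_map S)).

Lemma khat_coconeP (S T : khat_sys K Y) (h : ds_le S T) a :
  khat_cocone T (ds_map (khat_sys K Y) h a) = khat_cocone S a.
Proof.
have hX : @ds_le R (khat_sys K X) (dc_pull S) (dc_pull T) by move=> x y /h.
rewrite /khat_cocone /= -(colim_pi_map hX); congr colim_pi.
apply/funext => c /=; rewrite -[c]quot_reprK.
by rewrite !(dc_pull_map_pi, dc_mu_pi).
Qed.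

Definition khat_map : cinfHom (khat_ring K Y) (khat_ring K X) :=
  colim_desc khat_coconeP.

Lemma khat_mapE (S : khat_sys K Y) (u : ds_ob S) :
  khat_map (colim_map S u) =
  @colim_map R (khat_sys K X) (dc_pull S)
    (u \o @dc_pull_map S : cinf_pow K (quotSpace (dc_pull S))).
Proof. exact: colim_descE. Qed.

End KhatMap.

Lemma khat_map_id (R : realType) (K : cinfRing R) (X : boolSp) :
  khat_map K (cts_id X : ctsMap X X) = cinfHom_id (khat_ring K X).
Proof.
apply: colim_uniq => S u; rewrite khat_mapE.
apply/(@colim_piP R (khat_sys K X)).
have h : @ds_le R (khat_sys K X) (dc_pull (cts_id X) S) S by [].
exists S, h, (ds_refl S).
apply/funext => c /=; rewrite -[c]quot_reprK.
by rewrite !dc_mu_pi// dc_pull_map_pi.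
Qed.

Lemma khat_map_comp (R : realType) (K : cinfRing R) (X Y Z : boolSp)
    (g : ctsMap Y Z) (f : ctsMap X Y) :
  khat_map K (cts_comp g f) = cinfHom_comp (khat_map K f) (khat_map K g).
Proof.
apply: colim_uniq => S u; rewrite khat_mapE.
rewrite -[RHS]/(khat_map K f (khat_map K g (colim_map S u))) !khat_mapE.
apply/(@colim_piP R (khat_sys K X)).
have h : @ds_le R (khat_sys K X) (dc_pull (cts_comp g f) S)
  (dc_pull f (dc_pull g S)) by [].
exists (dc_pull f (dc_pull g S)), h, (ds_refl _).
apply/funext => c /=; rewrite -[c]quot_reprK.
by rewrite !dc_mu_pi// !dc_pull_map_pi.
Qed.

Definition khat (R : realType) (K : cinfRing R) (hK : cinf_field K) :
    cofunctor BoolSp (CinfvNRng R) :=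
  @Cofunctor BoolSp (CinfvNRng R)
    (fun X => exist _ (khat_ring K X) (khat_ring_vnr hK))
    (fun X Y f => khat_map K f)
    (fun X => khat_map_id K X)
    (fun X Y Z g f => khat_map_comp K g f).

Definition Kcheck (R : realType) (K : cinfRing R) (hK : cinf_field K) :
    functor BA (CinfvNRng R) :=
  cofunctor_comp (khat hK) Stone.

Definition Btilde_vN (R : realType) : functor (CinfvNRng R) BA :=
  functor_comp (Btilde R) (full_incl (@von_neumann_regular R : CinfRng R -> Prop)).

(* Main.v *)
Require Import Defs.
From HB Require Import structures.
From mathcomp Require Import all_boot all_order all_algebra.
From mathcomp Require Import all_classical all_reals.
From mathcomp Require Import topology.

Set Implicit Arguments.
Unset Strict Implicit.
Unset Printing Implicit Defensive.

(** The ring [khat_ring K X] is the ring of locally constant functions from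
    [X] to [K], presented as a colimit over the discrete compact quotients of
    [X]: every point of [X] gives an evaluation homomorphism to [K]
    ([khat_eval]), two elements with the same values are equal
    ([khat_eval_inj]), and values are locally constant ([khat_eval_open]).
    All identities below are therefore checked at points, where they become
    identities in the field [K].

    An idempotent takes at each point a value [a] with [a * a = a], that is 0
    or 1, so it is the indicator of a clopen subset of [X] ([idem_khatP]).
    When [X] is the Stone space of a Boolean algebra [B], Stone duality says
    that the clopen subsets are exactly the basic ones, each given by a unique
    element of [B]: existence is compactness ([clopen_stone_basic]), uniqueness
    is the existence of enough ultrafilters ([stone_basic_inj]).  Hence sending
    [b] to the indicator of the ultrafilters containing [b] is an isomorphism
    from [B] to the idempotents of the ring; it is natural because evaluating
    at [U] after applying [khat_map f] is evaluating at [f U]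
    ([khat_eval_map]).

    The remaining claims are formal.  If [G] after [F] is naturally isomorphic
    to the identity, then [F] reflects equality of arrows, every object [y] is
    isomorphic to [G (F y)], and every arrow [h] is conjugate to
    [fmap G (fmap F h)].  The [K]-algebra structure consists of the constant
    functions. *)

Import Order.Theory GRing.Theory.

Local Open Scope classical_set_scope.
Local Open Scope ring_scope.

(** * Stone representation of Boolean algebras *)

Section StoneRepresentation.
Context (B : boolAlg).

(** Ultrafilters are prime: if [x] is not in [U], its complement is, and the
    meet of that complement with the join of [x] and [y] lies below [y]. *)
Lemma uf_join (U : stone B) x y :
  uf_set U (Order.join x y) <-> uf_set U x \/ uf_set U y.
Proof.
split=> [Uxy|[]]; [|apply: ufS; exact: leUl|apply: ufS; exact: leUr].
have [Ux|Ucx] := ufC U x; [by left|right].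
apply: (ufS _ (ufI Ucx Uxy)).
by rewrite meetUr meetCx join0x leIr.
Qed.

(** Zorn's lemma for the proper filters containing [b], one of which is the
    principal filter of [b]. *)
Lemma exists_ultrafilter (b : B) :
  b != \bot%O -> exists U : stone B, uf_set U b.
Proof.
move=> b0.
have pb : ba_proper_filter [set x : B | (b <= x)%O].
  split=> /=.
  - exact: lex1.
  - by rewrite lex0; apply/negP.
  - by move=> x y bx byy; rewrite lexI bx.
  - by move=> x y xy bx; exact: le_trans xy.
(* The empty set is admitted because it is the union of the empty chain; it is
   not maximal, being contained in the principal filter of [b]. *)
pose P (F : set B) := F !=set0 -> ba_proper_filter F /\ F b.
have [F chF totF|A [PA maxA]] := @Zorn_bigcup _ P.
  move=> [x [X FX Xx]].
  have FP Y y : F Y -> Y y -> ba_proper_filter Y /\ Y b.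
    by move=> FY Yy; apply: (chF Y FY); exists y.
  have [[XT _ _ _] Xb] := FP _ _ FX Xx.
  split; last by exists X.
  split.
  - by exists X.
  - by move=> [Y FY Y0]; have [[_ + _ _] _] := FP _ _ FY Y0; apply.
  - move=> y z [Y FY Yy] [Z FZ Zz].
    have [YZ|ZY] := totF _ _ FY FZ.
    + have [[_ _ ZI _] _] := FP _ _ FZ Zz.
      by exists Z => //; apply: ZI => //; exact: YZ.
    + have [[_ _ YI _] _] := FP _ _ FY Yy.
      by exists Y => //; apply: YI => //; exact: ZY.
  - move=> y z yz [Y FY Yy].
    have [[_ _ _ YS] _] := FP _ _ FY Yy.
    by exists Y => //; exact: YS Yy.
have A0 : A !=set0.
  apply: contrapT => /set0P/negP/negPn/eqP A0.
  apply: (maxA [set x : B | (b <= x)%O]); last by move=> _; split=> /=.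
  split; first by rewrite A0.
  by move=> /(_ b (lexx b)); rewrite A0.
have [pA Ab] := PA A0.
suff uA : ba_ultrafilter A by exists (Ultra uA).
split=> // G pG AG; apply/seteqP; split=> //.
apply: contrapT => nGA; apply: (maxA G) => // _; split=> //; exact: AG.
Qed.

(** Otherwise some ultrafilter contains the nonzero element [x] minus [y], hence
    contains [x] but not [y]. *)
Lemma stone_basic_sub x y :
  stone_basic x `<=` stone_basic y -> (x <= y :> B)%O.
Proof.
move=> xy; rewrite -[y]complK -disj_leC.
apply: contrapT => /negP/exists_ultrafilter[U Uxy].
have Ux : uf_set U x by apply: ufS Uxy; exact: leIl.
have /uf_compl[] : uf_set U (Order.compl y) by apply: ufS Uxy; exact: leIr.
exact: xy.
Qed.

Lemma stone_basic_inj : injective (@stone_basic B).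
Proof.
by move=> x y xy; apply/le_anti/andP; split; apply: stone_basic_sub; rewrite xy.
Qed.

(** If no basic subset of [C] is all of [C], the complements in [C] of the basic
    subsets of [C] generate a proper filter, as basic subsets are closed under
    finite unions.  By compactness the filter clusters at some point of [C];
    but this point has a basic neighbourhood inside [C], whose complement
    belongs to the filter. *)
Lemma clopen_stone_basic (C : set (stone B)) :
  clopen C -> exists b, C = stone_basic b.
Proof.
move=> [oC cC].
pose F : set_system (stone B) := [set W | exists b : B,
  stone_basic b `<=` C /\ C `\` stone_basic b `<=` W].
have [/asboolP[b [bC Cb]]|nF] := boolP `[< F set0 >].
  exists b; apply/seteqP; split=> // U CU.
  by apply: contrapT => nU; exact: (Cb U).
have F_filter : Filter F.
  split.
  - by exists \bot%O; split=> // U /uf0.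
  - move=> W W' [b [bC bW]] [b' [bC' bW']]; exists (Order.join b b'); split.
      by move=> U /uf_join[/bC|/bC'].
    move=> U [CU nU]; split; [apply: bW|apply: bW']; split=> // Ub; apply: nU.
      by apply/uf_join; left.
    by apply/uf_join; right.
  - move=> W W' WW' [b [bC bW]]; exists b; split=> //.
    exact: subset_trans WW'.
have F_proper : ProperFilter F by split=> // F0; move/asboolP: nF.
have FC : F C by exists \bot%O; split=> [U /uf0//|U []].
have [U [CU clU]] := subclosed_compact cC (@stone_compact B) (@subsetT _ C) F_proper FC.
have [b [Ub bC]] := oC _ CU.
have Fb : F (C `\` stone_basic b) by exists b; split=> [|V].
have nb : nbhs U (stone_basic b) by apply: open_nbhs_nbhs; split=> //; exact: stone_basic_open.
by have [V [[_ nVb] Vb]] := clU _ _ Fb nb.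
Qed.

End StoneRepresentation.

(** * Elements of the colimit as locally constant functions *)

Section PointEvaluation.
Context {R : realType} (K : cinfRing R).

Definition cinf_pow_eval (S : Type) (t : S) : cinfHom (cinf_pow K S) K :=
  @CinfHom R (cinf_pow K S) K (fun u => u t) (fun n f s v => erefl).

Definition cinf_pow_const (S : Type) : cinfHom K (cinf_pow K S) :=
  @CinfHom R K (cinf_pow K S) (fun a => fun=> a) (fun n f s v => erefl).

Context (X : boolSp).

Definition khat_eval_cocone (x : X) (S : khat_sys K X) : cinfHom (ds_ob S) K :=
  cinf_pow_eval (quot_pi S x).

Lemma khat_eval_coconeP (x : X) (S T : khat_sys K X) (h : ds_le S T) a :
  khat_eval_cocone x T (ds_map (khat_sys K X) h a) = khat_eval_cocone x S a.
Proof. by rewrite /= dc_mu_pi. Qed.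

Definition khat_eval (x : X) : cinfHom (khat_ring K X) K :=
  colim_desc (khat_eval_coconeP x).

Lemma khat_evalE (x : X) (S : khat_sys K X) (u : ds_ob S) :
  khat_eval x (colim_map S u) = (u : quotSpace S -> K) (quot_pi S x).
Proof. exact: colim_descE. Qed.

(** Two representatives can be moved to a common quotient, where every class is
    the class of a point: hence their values there agree. *)
Lemma khat_eval_inj (z w : khat_ring K X) :
  (forall x, khat_eval x z = khat_eval x w) -> z = w.
Proof.
move: z w; apply: colim_ind => S u; apply: colim_ind => T v uv.
have [W [SW TW]] := ds_dir S T.
apply/colim_piP; exists W, SW, TW; apply/funext => c /=.
by have := uv (quot_repr c); rewrite !khat_evalE.
Qed.

Lemma khat_eval_open (z : khat_ring K X) (a : K) :
  open [set x | khat_eval x z = a].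
Proof.
move: z; apply: colim_ind => S u.
rewrite (_ : mkset _ = @quot_pi X S @^-1` [set c | (u : quotSpace S -> K) c = a]).
  have /continuousP := @quot_pi_continuous X S; apply; exact: dc_discrete.
by apply/funext => x; rewrite /mkset khat_evalE.
Qed.

End PointEvaluation.

Arguments khat_eval {R K X} x.

Lemma khat_eval_map (R : realType) (K : cinfRing R) (X Y : boolSp)
    (f : ctsMap X Y) (z : khat_ring K Y) (x : X) :
  khat_eval x (khat_map K f z) = khat_eval (f x) z.
Proof.
move: z; apply: colim_ind => S u.
by rewrite khat_mapE !khat_evalE /= dc_pull_map_pi.
Qed.

(** * Idempotents and clopen sets *)

Section Indicators.
Context {R : realType} (K : cinfRing R) (X : boolSp).

Definition same_side (C : set X) : eqvRel X.
Proof.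
refine (@EqvRel X (fun x y => C x <-> C y) _ _ _) => //.
- by move=> x y [].
- by move=> x y z [? ?] [? ?]; split; auto.
Defined.

Lemma same_side_discrete (C : set X) : clopen C ->
  forall A : set (quotSpace (same_side C)), open A.
Proof.
move=> [oC cC]; apply: open_class_discrete => x.
have [Cx|nCx] := pselect (C x).
  rewrite (_ : mkset _ = C) //.
  by apply/seteqP; split=> y /=; [move=> [+ _]; apply|].
rewrite (_ : mkset _ = ~` C); first exact: closed_openC.
by apply/seteqP; split=> y /= => [[_ Cyx] /Cyx|nCy]; [|split].
Qed.

Definition clopen_rel (C : set X) (hC : clopen C) : dcrel X :=
  DCrel (same_side_discrete hC) (quotSpace_compact (@bs_compact X)).

Definition indicator (C : set X) (hC : clopen C) : khat_ring K X :=
  @colim_map R (khat_sys K X) (clopen_rel hC)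
    (fun c => (`[< C (quot_repr c) >] : bool)%:R).

Lemma khat_eval_indicator (C : set X) (hC : clopen C) x :
  khat_eval x (indicator hC) = (`[< C x >] : bool)%:R.
Proof.
rewrite khat_evalE; congr (nat_of_bool _)%:R; apply: asbool_equiv_eq.
exact: (quot_repr_pi (clopen_rel hC) x).
Qed.

Lemma field_idem (a : K) : cinf_field K -> a * a = a -> a = 0 \/ a = 1.
Proof.
move=> [_ Kf] aa; have [->|/Kf[y ay]] := eqVneq a 0; [by left|right].
by rewrite -ay -[in RHS]aa -mulrA ay mulr1.
Qed.

(** The clopen set is the locus where [z] takes the value 1.  It is open, and so
    is its complement, the locus where [z] vanishes, since in a field 0 and 1
    are the only idempotents. *)
Lemma idem_khatP : cinf_field K -> forall z : khat_ring K X, z * z = z ->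
  exists (C : set X) (hC : clopen C), z = indicator hC.
Proof.
move=> hK z zz; have [K1 _] := hK.
have z01 x : khat_eval x z = 0 \/ khat_eval x z = 1.
  by apply: (field_idem hK); rewrite -cinfHomM zz.
pose C := [set x | khat_eval x z = 1].
have hC : clopen C.
  split; first exact: khat_eval_open.
  rewrite -[C]setCK; apply: open_closedC.
  rewrite (_ : ~` C = [set x | khat_eval x z = 0]); first exact: khat_eval_open.
  apply/seteqP; split=> x /=; first by have [|/[swap]] := z01 x.
  by rewrite /C /= => -> /esym /eqP; rewrite (negbTE K1).
exists C, hC; apply: khat_eval_inj => x; rewrite khat_eval_indicator.
case: asboolP => [//|nC]; by have [|/nC] := z01 x.
Qed.

End Indicators.

(** * The natural isomorphism *)

Section Theta.
Context {R : realType} (K : cinfRing R).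

Section Object.
Context (B : boolAlg).
Let A := khat_ring K (stoneSp B).

Definition basic_indicator (b : B) : A :=
  @indicator R K (stoneSp B) _ (stone_basic_clopen b).

Lemma khat_eval_basic (b : B) (U : stoneSp B) :
  khat_eval U (basic_indicator b) = (`[< uf_set U b >] : bool)%:R.
Proof. exact: khat_eval_indicator. Qed.

Lemma basic_indicator_idem (b : B) : basic_indicator b ^+ 2 == basic_indicator b.
Proof.
apply/eqP; apply: khat_eval_inj => U; rewrite expr2 cinfHomM khat_eval_basic.
by case: asboolP; rewrite ?mulr1 ?mulr0.
Qed.

Definition theta_fun (b : B) : idemAlg A := Idem (basic_indicator_idem b).

Lemma theta_meet : Order.meet_morphism theta_fun.
Proof.
move=> x y; apply: idem_ext; apply: khat_eval_inj => U.
rewrite -[RHS]/(khat_eval U (basic_indicator x * basic_indicator y)).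
rewrite cinfHomM !khat_eval_basic.
have -> : `[< uf_set U (Order.meet x y) >] = `[< uf_set U x >] && `[< uf_set U y >].
  rewrite -asbool_and; apply: asbool_equiv_eq; split=> [Uxy|[]]; last exact: ufI.
  by split; apply: ufS Uxy; [exact: leIl|exact: leIr].
by rewrite -mulnb natrM.
Qed.

Lemma theta_join : Order.join_morphism theta_fun.
Proof.
move=> x y; apply: idem_ext; apply: khat_eval_inj => U.
rewrite -[RHS]/(khat_eval U (basic_indicator x + basic_indicator y
  - basic_indicator x * basic_indicator y)).
rewrite !cinfHomD cinfHomN cinfHomM !khat_eval_basic.
rewrite (asbool_equiv_eq (uf_join U x y)) asbool_or.
case: `[< uf_set U x >]; case: `[< uf_set U y >] => /=.
- by rewrite mulr1 addrK.
- by rewrite mulr0 addr0 subr0.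
- by rewrite mul0r subr0 add0r.
- by rewrite mul0r subr0 add0r.
Qed.

Lemma theta_bot : theta_fun \bot%O = \bot%O.
Proof.
apply: idem_ext; apply: khat_eval_inj => U.
by rewrite [RHS]cinfHom0 khat_eval_basic asboolF//; exact: uf0.
Qed.

Lemma theta_top : theta_fun \top%O = \top%O.
Proof.
apply: idem_ext; apply: khat_eval_inj => U.
by rewrite [RHS]cinfHom1 khat_eval_basic asboolT//; exact: ufT.
Qed.

Definition theta : baHom B (idemAlg A) :=
  BaHom theta_meet theta_join theta_bot theta_top.

(** As 1 and 0 differ in [K], the indicator of a set determines the set, and a
    basic set determines the element of [B]. *)
Lemma theta_inj : cinf_field K -> injective theta.
Proof.
move=> [K1 _] x y /(congr1 val) /= xy; apply: stone_basic_inj.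
have H (U : stone B) : `[< uf_set U x >] = `[< uf_set U y >].
  have := congr1 (khat_eval (U : stoneSp B)) xy.
  rewrite !khat_eval_basic; do 2 case: asboolP => _ //.
    by move=> /eqP; rewrite (negbTE K1).
  by move=> /esym/eqP; rewrite (negbTE K1).
apply/seteqP; split=> U /asboolP Ux; apply/asboolP; move: Ux;
  by rewrite -[asbool (stone_basic _ _)]/`[< uf_set U _ >] H.
Qed.

Lemma theta_surj : cinf_field K -> forall e : idemAlg A, exists b, theta b = e.
Proof.
move=> hK e; have [C [hC eE]] := idem_khatP hK (idemP e).
have [b Cb] := @clopen_stone_basic B C hC.
exists b; apply: idem_ext; rewrite eE /=; apply: khat_eval_inj => U.
by rewrite khat_eval_basic khat_eval_indicator Cb.
Qed.

End Object.

Lemma theta_natural (B B' : boolAlg) (h : baHom B B') (b : B) :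
  theta B' (h b) = idem_map (khat_map K (stone_map h)) (theta B b).
Proof.
apply: idem_ext; apply: khat_eval_inj => U.
by rewrite [RHS]khat_eval_map !khat_eval_basic.
Qed.

End Theta.

(** The inverse map preserves the operations because [f] is injective. *)
Lemma bijective_baHom_iso (B B' : boolAlg) (f : baHom B B') :
  injective f -> (forall y, exists x, f x = y) -> @is_iso BA B B' f.
Proof.
move=> fI /choice[g gK].
have gI : Order.meet_morphism g by move=> x y; apply: fI; rewrite ba_homI !gK.
have gU : Order.join_morphism g by move=> x y; apply: fI; rewrite ba_homU !gK.
have g0 : g \bot%O = \bot%O by apply: fI; rewrite ba_hom0 gK.
have g1 : g \top%O = \top%O by apply: fI; rewrite ba_hom1 gK.
exists (BaHom gI gU g0 g1); split; apply: baHom_ext => x //=.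
by apply: fI; rewrite gK.
Qed.

(** * Formal consequences of a natural isomorphism to the identity *)

Section SectionUpToIso.
(* [hom], [comp] and [compA] mean those of a category here. *)
Import Defs.
Context (C D : category) (F : functor D C) (G : functor C D).
Context (t : nat_trans (functor_id D) (functor_comp G F)) (ti : nat_iso t).

(** The naturality square of [t] at [h], composed with the inverse of
    [t y']. *)
Lemma nat_iso_conj (y y' : D) (h : hom y y') :
  exists (i : iso y (G (F y))) (i' : iso y' (G (F y'))),
    h = comp (iso_inv i') (comp (fmap G (fmap F h)) i).
Proof.
have [g [tK gK]] := ti y; have [g' [tK' gK']] := ti y'.
exists (Iso tK gK), (Iso tK' gK') => /=.
by rewrite -[comp (fmap G _) _](nt_nat t h) compA tK' comp_idl.
Qed.

Lemma faithful_of_nat_iso : faithful F.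
Proof.
move=> y y' f g fg; have [s' [tK _]] := ti y'.
have E (k : hom y y') : k = comp s' (comp (fmap G (fmap F k)) (t y)).
  by rewrite -[comp (fmap G _) _](nt_nat t k) compA tK comp_idl.
by rewrite (E f) (E g) fg.
Qed.

Lemma full_up_to_conjugation_of_nat_iso : full_up_to_conjugation G.
Proof.
move=> y y' h; have [i [i' hE]] := nat_iso_conj h.
by exists (F y), (F y'), (fmap F h), i, i'.
Qed.

Lemma iso_of_nat_iso (y : D) : inhabited (iso (G (F y)) y).
Proof. by have [g [tK gK]] := ti y; constructor; exact: Iso gK tK. Qed.

Lemma iso_dense_of_nat_iso : iso_dense G.
Proof. by move=> y; exists (F y); exact: iso_of_nat_iso. Qed.

End SectionUpToIso.

(** * The theorem *)

Definition theta_nat (R : realType) (K : cinfRing R) (hK : cinf_field K) :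
    nat_trans (functor_id BA) (functor_comp (Btilde_vN R) (Kcheck hK)).
Proof.
refine (@NatTrans BA BA (functor_id BA)
  (functor_comp (Btilde_vN R) (Kcheck hK)) (@theta R K) _).
by move=> B B' h; apply: baHom_ext => b; exact: theta_natural.
Defined.

Lemma theta_nat_iso (R : realType) (K : cinfRing R) (hK : cinf_field K) :
  nat_iso (theta_nat hK).
Proof.
by move=> B; apply: bijective_baHom_iso; [exact: theta_inj|exact: theta_surj].
Qed.

Lemma khat_ring_algebra (R : realType) (K : cinfRing R) (X : boolSp) :
  is_algebra K (khat_ring K X).
Proof.
constructor; exact: cinfHom_comp
  (@colim_map R (khat_sys K X) (dcT (@bs_compact X))) (cinf_pow_const K _).
Qed.

Theorem theorem4p7 (R : realType) (K : cinfRing R) (hK : cinf_field K) :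
  (exists theta : nat_trans (functor_id BA)
                            (functor_comp (Btilde_vN R) (Kcheck hK)),
     nat_iso theta) /\
  faithful (Kcheck hK) /\
  full_up_to_conjugation (Btilde_vN R) /\
  (iso_dense (Btilde_vN R) /\
   forall (K' : cinfRing R) (hK' : cinf_field K') (B : BA),
     von_neumann_regular (full_incl _ (Kcheck hK' B)) /\
     is_algebra K' (full_incl _ (Kcheck hK' B)) /\
     inhabited (iso (Btilde_vN R (Kcheck hK' B)) B)).
Proof.
split; first by exists (theta_nat hK); exact: theta_nat_iso.
split; first exact: faithful_of_nat_iso (theta_nat_iso hK).
split; first exact: full_up_to_conjugation_of_nat_iso (theta_nat_iso hK).
split; first exact: iso_dense_of_nat_iso (theta_nat_iso hK).
move=> K' hK' B; split; first exact: khat_ring_vnr hK'.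
split; first exact: khat_ring_algebra.
exact: iso_of_nat_iso (theta_nat_iso hK') B.
Qed.
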